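(* For every decidable propositional logic $\mathbf{L}$ in a propositional language $\mathcal{L}$ there is a sequence $\mathbf{A}=\langle \mathbf{M}_1,\mathbf{M}_2,\mathbf{M}_3,\dots\rangle$ of many-valued logics $\mathbf{M}_i$ over $\mathcal{L}$ satisfying 1. $\mathbf{A}$ is given by a recursive procedure, 2. $\mathbf{M}_i\unlhd\mathbf{M}_j$ iff $i\ge j$, and 3. $\mathbf{L}\subseteq\mathrm{Taut}(\mathbf{M}_i)$, such that $\mathbf{L}=\bigcap_{i\ge 2}\mathrm{Taut}(\mathbf{M}_i)$.
   Context: A propositional language $\mathcal{L}$ has propositional variables $X_0,X_1,X_2,\dots$ and finitely many connectives of fixed finite arities (connectives of arity $0$ are propositional constants). $\mathrm{Frm}(\mathcal{L})$ is the set of formulas. A propositional logic in $\mathcal{L}$ is a subset of $\mathrm{Frm}(\mathcal{L})$ closed under substitution; it is decidable if it is a decidable set of formulas. Many-valued logics are here finite-valued: such a logic $\mathbf{M}$ over $\mathcal{L}$ is given by a finite set $V(\mathbf{M})$ of truth values, a set $V^+(\mathbf{M})\subseteq V(\mathbf{M})$ of designated truth values, and a truth function $V(\mathbf{M})^{n}\to V(\mathbf{M})$ for each $n$-ary connective of $\mathcal{L}$. A valuation maps the propositional variables to $V(\mathbf{M})$ and is extended to all formulas via the truth functions; it satisfies $F$ if the value of $F$ is in $V^+(\mathbf{M})$. $\mathrm{Taut}(\mathbf{M})$ is the set of formulas satisfied by every valuation (the tautologies of $\mathbf{M}$). For two many-valued logics, $\mathbf{M}\unlhd\mathbf{M}'$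 iff $\mathrm{Taut}(\mathbf{M})\subseteq\mathrm{Taut}(\mathbf{M}')$.
   Formalization: In 2, ''M_i ⊴ M_j only if i ≥ j'' is claimed only when formulas outside L occur at arbitrarily large depth; otherwise (e.g. L = all formulas) only finitely many substitution-closed sets contain L and it is false. All other claims are made for every decidable L. *)

(* Defs.v *)
From mathcomp Require Import all_boot.

Set Implicit Arguments.
Unset Strict Implicit.
Unset Printing Implicit Defensive.

(* Kleene's total (general) recursive functions: the least class containing
   zero, successor and projections that is closed under composition, primitive
   recursion and minimization of regular functions.  The defined function is
   characterized pointwise by its equations, so the class is closed under
   extensional equality. *)
Inductive recursive : forall n : nat, (n.-tuple nat -> nat) -> Prop :=
| rec_zero n (h : n.-tuple nat -> nat) :
    (forall x, h x = 0) -> recursive h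
| rec_succ (h : 1.-tuple nat -> nat) :
    (forall x, h x = (thead x).+1) -> recursive h
| rec_proj n (i : 'I_n) (h : n.-tuple nat -> nat) :
    (forall x, h x = tnth x i) -> recursive h
| rec_comp m n (f : m.-tuple nat -> nat) (g : 'I_m -> n.-tuple nat -> nat)
    (h : n.-tuple nat -> nat) :
    recursive f -> (forall i, recursive (g i)) ->
    (forall x, h x = f [tuple g i x | i < m]) -> recursive h
| rec_prim n (f : n.-tuple nat -> nat) (g : n.+2.-tuple nat -> nat)
    (h : n.+1.-tuple nat -> nat) :
    recursive f -> recursive g ->
    (forall x : n.-tuple nat, h [tuple of 0 :: x] = f x) ->
    (forall y (x : n.-tuple nat), h [tuple of y.+1 :: x] =
       g [tuple of y :: h [tuple of y :: x] :: x]) ->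
    recursive h
| rec_mu n (f : n.+1.-tuple nat -> nat) (h : n.-tuple nat -> nat) :
    recursive f ->
    (forall x : n.-tuple nat, f [tuple of h x :: x] = 0) ->
    (forall (x : n.-tuple nat) y, y < h x -> f [tuple of y :: x] <> 0) ->
    recursive h.

Record language := Language {
  connective : finType;
  arity : connective -> nat
}.

Inductive formula (L : language) : Type :=
| Var of nat
| App (c : connective L) of {ffun 'I_(arity c) -> formula L}.

Arguments Var {L} n.
Arguments App {L} c a.

Fixpoint subst (L : language) (s : nat -> formula L) (F : formula L)
    : formula L :=
  match F with
  | Var n => s n
  | App c a => App c [ffun i => subst s (a i)]
  end.

(* Variables have depth 0, propositional constants have depth 1. *)
Fixpoint depth (L : language) (F : formula L) : nat :=
  match F with
  | Var _ => 0
  | App c a => (\max_(i < arity c) depth (a i)).+1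
  end.

(* Goedel number, based on the bijection CodeSeq.code : seq nat -> nat; the
   leading entry 0 marks a variable, k.+1 marks the k-th connective. *)
Fixpoint godel (L : language) (F : formula L) : nat :=
  match F with
  | Var n => CodeSeq.code [:: 0; n]
  | App c a =>
      CodeSeq.code ((enum_rank c).+1 ::
                    [seq godel (a i) | i <- enum 'I_(arity c)])
  end.

Definition propositional_logic (L : language) (Lg : formula L -> Prop) : Prop :=
  forall (s : nat -> formula L) F, Lg F -> Lg (subst s F).

Definition decidable_logic (L : language) (Lg : formula L -> Prop) : Prop :=
  exists2 d : 1.-tuple nat -> nat, recursive d &
    forall F, Lg F <-> d [tuple godel F] = 1.

Record mvlogic (L : language) := MVLogic {
  truth_value : finType;
  designated : {set truth_value};
  truth_fun : forall c : connective L,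
    {ffun 'I_(arity c) -> truth_value} -> truth_value
}.

Fixpoint value (L : language) (M : mvlogic L) (v : nat -> truth_value M)
    (F : formula L) : truth_value M :=
  match F with
  | Var n => v n
  | App c a => truth_fun [ffun i => value v (a i)]
  end.

Definition Taut (L : language) (M : mvlogic L) (F : formula L) : Prop :=
  forall v : nat -> truth_value M, value v F \in designated M.

Definition mv_le (L : language) (M M' : mvlogic L) : Prop :=
  forall F, Taut M F -> Taut M' F.

(* The family M_1, M_2, ... is given by a recursive procedure: from i one
   computes the number of truth values of M_i (an explicit bound for its finite
   domain, not just a decision procedure for it), the designated values and all
   truth functions, uniformly in i.  Truth values are named 0, ..., #|V|.-1 by
   [enum_rank].  Sequences start at index 1; A 0 is irrelevant. *)
Definition recursive_sequence (L : language) (A : nat -> mvlogic L) : Prop :=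
  exists (card : 1.-tuple nat -> nat) (desig : 2.-tuple nat -> nat)
         (tf : forall c : connective L, (arity c).+1.-tuple nat -> nat),
    [/\ recursive card,
        recursive desig,
        forall c, recursive (tf c)
      & forall i, 0 < i ->
        [/\ card [tuple i] = #|truth_value (A i)|,
            forall u : truth_value (A i),
              (u \in designated (A i)) =
              (desig [tuple i; nat_of_ord (enum_rank u)] == 1)
          & forall (c : connective L)
                   (a : {ffun 'I_(arity c) -> truth_value (A i)}),
              tf c [tuple of i ::
                     [tuple nat_of_ord (enum_rank (a j)) | j < arity c]] =
              enum_rank (truth_fun a)]].

(* Formulas outside Lg occur at arbitrarily large depth.  If this fails, only
   finitely many substitution-closed sets contain Lg (up to renaming of
   variables there are finitely many formulas of bounded depth), so no
   infinite strictly decreasing sequence of sets Taut(M_i) can contain Lg;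
   Lg = Frm(L) is the simplest such case. *)
Definition deep_nontheorems (L : language) (Lg : formula L -> Prop) : Prop :=
  forall n, exists2 F, n < depth F & ~ Lg F.

(* Main.v *)
Require Import Defs.
From mathcomp Require Import all_boot.
From Stdlib Require Import Classical ClassicalEpsilon.

Set Implicit Arguments.
Unset Strict Implicit.
Unset Printing Implicit Defensive.

(** Identify formulas with their Goedel numbers.  The n-th approximation of
    the logic has the numbers 0, ..., n as truth values: a number below n
    stands for itself, and n means that the value is too large to be recorded.
    A connective applies itself symbolically to the numbers of its arguments
    and truncates the result at n.  Undesignated are exactly the numbers below
    n of formulas outside the logic.

    The number of a compound formula exceeds those of its parts, so an
    oversized argument forces an oversized value; likewise a number that is
    not a formula code never becomes part of one.  Hence a valuation whose
    value at F is the code of a formula acts on F as a substitution, and F is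
    a tautology iff every substitution instance of F with code below n belongs
    to the logic ([Taut_truncated]).  This yields at once that the logic is
    contained in each approximation, that the approximations shrink as n
    grows, and, taking the identity substitution, that every non-theorem F is
    refuted as soon as n exceeds the code of F.

    Strictness needs a choice of thresholds N 1 < N 2 < ....  Substitution
    never decreases depth and depth is bounded by the code, so a formula
    deeper than n has no instance with code below n, hence is a tautology of
    the n-th approximation.  If there are arbitrarily deep non-theorems, then
    N (i + 1) is put just above the code of the first non-theorem deeper than
    N i: this formula separates the two approximations
    ([separating_thresholds]).  The case distinction on whether deep
    non-theorems exist is not effective, but in either case the resulting
    sequence is recursive.

    Recursiveness amounts to computing, from a number, whether it codes a
    formula and how deep that formula is; this goes by course-of-values
    recursion on the code ([course_of_values], [code_depth]). *)

(** * Closure properties of the recursive functions *)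

Definition recursive1 (f : nat -> nat) :=
  recursive (fun x : 1.-tuple nat => f (tnth x ord0)).

Definition recursive2 (f : nat -> nat -> nat) :=
  recursive (fun x : 2.-tuple nat => f (tnth x ord0) (tnth x (inord 1))).

Lemma recursive_ext n (f h : n.-tuple nat -> nat) :
  recursive f -> f =1 h -> recursive h.
Proof.
move=> rf fh; apply: (rec_comp (g := fun i x => tnth x i) rf) => [i|x].
  exact: (rec_proj (i := i)).
by rewrite -fh; congr (f _); apply: eq_from_tnth => i; rewrite tnth_mktuple.
Qed.

Lemma recursive_proj n (i : 'I_n) : recursive (fun x : n.-tuple nat => tnth x i).
Proof. exact: (rec_proj (i := i)). Qed.

Lemma recursive_comp1 n (f : nat -> nat) (g : n.-tuple nat -> nat) :
  recursive1 f -> recursive g -> recursive (fun x => f (g x)).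
Proof.
move=> rf rg; apply: (rec_comp (g := fun=> g) rf) => // x.
by rewrite tnth_mktuple.
Qed.

Lemma recursive_comp2 n (f : nat -> nat -> nat) (g1 g2 : n.-tuple nat -> nat) :
  recursive2 f -> recursive g1 -> recursive g2 ->
  recursive (fun x => f (g1 x) (g2 x)).
Proof.
move=> rf rg1 rg2.
apply: (rec_comp (g := fun i => if i == ord0 then g1 else g2) rf) => [i|x].
  by case: ifP.
by rewrite !tnth_mktuple eqxx -val_eqE /= inordK.
Qed.

Lemma recursive_succ n (g : n.-tuple nat -> nat) :
  recursive g -> recursive (fun x => (g x).+1).
Proof. by apply: (@recursive_comp1 _ succn); apply: rec_succ => x; congr _.+1. Qed.

Lemma recursive_const n k : recursive (fun _ : n.-tuple nat => k).
Proof.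
elim: k => [|k IHk]; first exact: rec_zero.
exact: recursive_succ.
Qed.

Lemma recursive2_prim (b : nat -> nat) (s : nat -> nat -> nat -> nat)
    (h : nat -> nat -> nat) :
  recursive1 b ->
  recursive (fun x : 3.-tuple nat =>
    s (tnth x ord0) (tnth x (inord 1)) (tnth x (inord 2))) ->
  (forall p, h 0 p = b p) ->
  (forall k p, h k.+1 p = s k (h k p) p) -> recursive2 h.
Proof.
move=> rb rs h0 hS; apply: (rec_prim rb rs) => [x|y x]; rewrite !(tnth_nth 0) /=.
  by rewrite inordK.
by rewrite !inordK.
Qed.

Lemma recursive1_prim (b : nat) (s : nat -> nat -> nat) (h : nat -> nat) :
  recursive2 s -> h 0 = b -> (forall k, h k.+1 = s k (h k)) -> recursive1 h.
Proof.
move=> rs h0 hS; apply: (rec_prim (recursive_const 0 b) rs) => [x|y x].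
  by rewrite (tnth_nth 0).
by rewrite !(tnth_nth 0) /= inordK.
Qed.

Lemma recursive1_iter (s : nat -> nat) :
  recursive1 s -> recursive2 (fun k x => iter k s x).
Proof.
move=> rs; apply: (recursive2_prim (b := id) (s := fun _ y _ => s y)) => //.
  exact: recursive_proj.
by apply: recursive_comp1; first exact: rs; apply: recursive_proj.
Qed.

(** Minimization for a decidable relation that always has a witness; a truth
    value is computed as 0 or 1, so the search is for a zero of the negation. *)
Lemma recursive1_mu (P : nat -> nat -> bool) (h : nat -> nat) :
  recursive2 (fun y p => ~~ P y p) -> (forall p, P (h p) p) ->
  (forall p y, P y p -> h p <= y) -> recursive1 h.
Proof.
move=> rP Ph hmin; apply: (rec_mu rP) => [x|x y];
  rewrite !(tnth_nth 0) /= inordK //= ?Ph // => lt_yh.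
have [Py|//] := boolP (P y _).
by have := hmin _ _ Py; rewrite leqNgt lt_yh.
Qed.

Lemma recursive1_pred : recursive1 predn.
Proof. by apply: (@recursive1_prim 0 (fun k _ => k)) => //; apply: recursive_proj. Qed.

Lemma recursive1_eq0 : recursive1 (fun k => k == 0).
Proof. by apply: (@recursive1_prim 1 (fun _ _ => 0)) => //; apply: recursive_const. Qed.

Lemma recursive_pred n (g : n.-tuple nat -> nat) :
  recursive g -> recursive (fun x => (g x).-1).
Proof. exact: (recursive_comp1 recursive1_pred). Qed.

Lemma recursive_eq0 n (g : n.-tuple nat -> nat) :
  recursive g -> recursive (fun x => g x == 0).
Proof. exact: (recursive_comp1 recursive1_eq0). Qed.

Lemma recursive_neg n (P : n.-tuple nat -> bool) :
  recursive P -> recursive (fun x => ~~ P x).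
Proof.
by move=> rP; apply: (recursive_ext (recursive_eq0 rP)) => x; case: (P x).
Qed.

Lemma recursive_add n (f g : n.-tuple nat -> nat) :
  recursive f -> recursive g -> recursive (fun x => f x + g x).
Proof.
move=> rf rg; apply: (recursive_comp2 _ rf rg).
apply: (@recursive2_prim id (fun _ y _ => y.+1)) => //.
  exact: recursive_proj.
by apply: recursive_succ; apply: recursive_proj.
Qed.

Lemma recursive_sub n (f g : n.-tuple nat -> nat) :
  recursive f -> recursive g -> recursive (fun x => f x - g x).
Proof.
move=> rf rg; apply: (recursive_comp2 (f := fun k m => m - k) _ rg rf).
apply: (@recursive2_prim id (fun _ y _ => y.-1)).
- exact: recursive_proj.
- by apply: recursive_pred; apply: recursive_proj.
- exact: subn0.
- by move=> k p; rewrite subnS.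
Qed.

Lemma recursive_mul n (f g : n.-tuple nat -> nat) :
  recursive f -> recursive g -> recursive (fun x => f x * g x).
Proof.
move=> rf rg; apply: (recursive_comp2 _ rf rg).
apply: (@recursive2_prim (fun=> 0) (fun _ y p => p + y)) => //.
  exact: recursive_const.
by apply: recursive_add; apply: recursive_proj.
Qed.

Lemma recursive_and n (P Q : n.-tuple nat -> bool) :
  recursive P -> recursive Q -> recursive (fun x => P x && Q x).
Proof.
move=> rP rQ; apply: (recursive_ext (recursive_mul rP rQ)) => x.
exact: mulnb.
Qed.

Lemma recursive_or n (P Q : n.-tuple nat -> bool) :
  recursive P -> recursive Q -> recursive (fun x => P x || Q x).
Proof.
move=> rP rQ.
have := recursive_neg (recursive_and (recursive_neg rP) (recursive_neg rQ)).
by move=> r; apply: (recursive_ext r) => x; rewrite negb_and !negbK.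
Qed.

Lemma recursive_leq n (f g : n.-tuple nat -> nat) :
  recursive f -> recursive g -> recursive (fun x => f x <= g x).
Proof. by move=> rf rg; apply: recursive_eq0; apply: recursive_sub. Qed.

Lemma recursive_eq n (f g : n.-tuple nat -> nat) :
  recursive f -> recursive g -> recursive (fun x => f x == g x).
Proof.
move=> rf rg.
apply: (recursive_ext (recursive_and (recursive_leq rf rg) (recursive_leq rg rf))).
by move=> x; rewrite eqn_leq.
Qed.

Lemma recursive_max n (f g : n.-tuple nat -> nat) :
  recursive f -> recursive g -> recursive (fun x => maxn (f x) (g x)).
Proof.
move=> rf rg; apply: (recursive_ext (recursive_add rf (recursive_sub rg rf))).
by move=> x; rewrite maxnE.
Qed.

Lemma recursive_min n (f g : n.-tuple nat -> nat) :
  recursive f -> recursive g -> recursive (fun x => minn (f x) (g x)).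
Proof.
move=> rf rg; apply: (recursive_ext (recursive_sub rf (recursive_sub rf rg))).
by move=> x; rewrite minnE.
Qed.

(** Quantification over connectives or over the arguments of a connective is
    a fixed finite iteration, not one whose length is part of the input. *)
Lemma recursive_bigop n (I : Type) (op : nat -> nat -> nat) (idx : nat)
    (r : seq I) (F : I -> n.-tuple nat -> nat) :
  (forall f g : n.-tuple nat -> nat,
     recursive f -> recursive g -> recursive (fun x => op (f x) (g x))) ->
  (forall i, recursive (F i)) -> recursive (fun x => \big[op/idx]_(i <- r) F i x).
Proof.
move=> rop rF; elim: r => [|i r IHr].
  apply: (recursive_ext (recursive_const n idx)) => x; by rewrite big_nil.
apply: (recursive_ext (rop _ _ (rF i) IHr)) => x; by rewrite big_cons.
Qed.

Lemma recursive1_odd : recursive1 odd.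
Proof.
apply: (@recursive1_prim 0 (fun _ b => b == 0)) => // [|k].
  by apply: recursive_eq0; apply: recursive_proj.
by rewrite /=; case: (odd k).
Qed.

Lemma recursive1_half : recursive1 half.
Proof.
apply: (@recursive1_prim 0 (fun k y => odd k + y)) => // [|k].
  apply: recursive_add; last exact: recursive_proj.
  exact: (recursive_comp1 recursive1_odd (recursive_proj _)).
by rewrite /= uphalf_half.
Qed.

Lemma recursive1_exp2 : recursive1 (expn 2).
Proof.
apply: (@recursive1_prim 1 (fun _ y => y + y)) => // [|k].
  by apply: recursive_add; apply: recursive_proj.
by rewrite expnS mul2n addnn.
Qed.

(** * Coded sequences and course-of-values recursion *)

Definition code_head u := head 0 (CodeSeq.decode u).
Definition code_tail u := CodeSeq.code (behead (CodeSeq.decode u)).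

Lemma recursive_code_cons n (f : n.-tuple nat -> nat)
    (g : n.-tuple nat -> seq nat) :
  recursive f -> recursive (fun x => CodeSeq.code (g x)) ->
  recursive (fun x => CodeSeq.code (f x :: g x)).
Proof.
move=> rf rg; apply: recursive_mul; first exact: (recursive_comp1 recursive1_exp2).
apply: recursive_succ; apply: (recursive_ext (recursive_add rg rg)) => x.
by rewrite addnn.
Qed.

(** The head of a sequence is the exponent of 2 in its code, so repeated
    halving reaches an odd number after exactly that many steps. *)
Lemma iter_half_code k s j : j <= k ->
  iter j half (CodeSeq.code (k :: s)) = 2 ^ (k - j) * (CodeSeq.code s).*2.+1.
Proof.
elim: j => [|j IHj] lt_jk; first by rewrite subn0.
rewrite iterS IHj ?(ltnW lt_jk) // -(subnSK lt_jk) expnS -mulnA mul2n.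
exact: doubleK.
Qed.

Lemma recursive1_code_head : recursive1 code_head.
Proof.
(* The empty sequence has code 0, which stays even: it is admitted apart. *)
apply: (@recursive1_mu (fun k u => odd (iter k half u) || (u == 0))).
- apply: recursive_neg; apply: recursive_or.
    apply: (recursive_comp1 recursive1_odd).
    by apply: (recursive_comp2 (recursive1_iter recursive1_half));
      apply: recursive_proj.
  by apply: recursive_eq0; apply: recursive_proj.
- move=> u; rewrite /code_head -{2 3}(CodeSeq.decodeK u).
  case: (CodeSeq.decode u) => [|k s] //=.
  by rewrite iter_half_code // subnn mul1n /= odd_double.
- move=> u j; rewrite /code_head -{1 2}(CodeSeq.decodeK u).
  case: (CodeSeq.decode u) => [|k s] //; rewrite [head _ _]/=.
  rewrite muln_eq0 expn_eq0 /= orbF; apply: contraTT; rewrite -ltnNge => lt_jk.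
  by rewrite iter_half_code ?(ltnW lt_jk) // -(subnSK lt_jk) expnS oddM oddM.
Qed.

Lemma recursive1_code_tail : recursive1 code_tail.
Proof.
apply: (recursive_ext (f := fun x =>
  half (iter (code_head (tnth x ord0)) half (tnth x ord0)))).
  apply: (recursive_comp1 recursive1_half).
  apply: (recursive_comp2 (recursive1_iter recursive1_half)).
    exact: recursive1_code_head.
  exact: recursive_proj.
move=> x; move: (tnth x ord0) => u.
rewrite /code_tail /code_head -{2}(CodeSeq.decodeK u).
case: (CodeSeq.decode u) => [|k s] //; rewrite [head _ _]/= [behead _]/=.
by rewrite iter_half_code // subnn mul1n /= uphalf_double.
Qed.

Definition code_nth u k := nth 0 (CodeSeq.decode u) k.

Lemma recursive_code_nth n (f g : n.-tuple nat -> nat) :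
  recursive f -> recursive g -> recursive (fun x => code_nth (f x) (g x)).
Proof.
move=> rf rg; apply: (recursive_comp2 _ rf rg).
apply: (recursive_ext (f := fun x =>
  code_head (iter (tnth x (inord 1)) code_tail (tnth x ord0)))).
  apply: (recursive_comp1 recursive1_code_head).
  by apply: (recursive_comp2 (recursive1_iter recursive1_code_tail));
    apply: recursive_proj.
move=> x; rewrite /code_nth; move: (tnth x ord0) (tnth x (inord 1)) => u k.
elim: k u => [|k IHk] u; first by rewrite /= /code_head -nth0.
by rewrite iterSr IHk /code_tail CodeSeq.codeK nth_behead.
Qed.

Lemma recursive_code_map n (I : Type) (r : seq I) (F : I -> n.-tuple nat -> nat) :
  (forall i, recursive (F i)) ->
  recursive (fun x => CodeSeq.code [seq F i x | i <- r]).
Proof.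
move=> rF; elim: r => [|i r IHr]; first exact: recursive_const.
exact: (recursive_code_cons (rF i) IHr).
Qed.

(** All earlier values are carried along in one coded list.  Consing puts the
    newest value first, which is why the table is reversed. *)
Lemma course_of_values (step : nat -> nat -> nat) :
  recursive2 step ->
  exists2 f : nat -> nat, recursive1 f &
    forall n, f n = step n (CodeSeq.code (rev (mkseq f n))).
Proof.
move=> rstep.
pose next n t := CodeSeq.code (step n t :: CodeSeq.decode t).
pose table := fix table n := if n is m.+1 then next m (table m) else 0.
have rtable : recursive1 table.
  apply: (@recursive1_prim 0 next) => //.
  apply: recursive_code_cons; first exact: rstep.
  apply: (recursive_ext (recursive_proj _)) => x; exact/esym/CodeSeq.decodeK.
exists (fun n => step n (table n)).
  by apply: (recursive_comp2 rstep) => //; apply: recursive_proj.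
move=> n; congr (step n _).
elim: n => // n IHn.
by rewrite mkseqS rev_rcons -(CodeSeq.codeK (rev _)) -IHn.
Qed.

(** * Formulas and their codes *)

Section Formulas.

Variable L : language.
Implicit Types (F G : formula L) (c : connective L) (s : nat -> formula L).

(** The symbolic application of a connective to arbitrary numbers, whether or
    not they are codes of formulas. *)
Definition code_app c (h : 'I_(arity c) -> nat) : nat :=
  CodeSeq.code ((enum_rank c).+1 :: [seq h i | i <- enum 'I_(arity c)]).

Lemma godel_App c (a : {ffun 'I_(arity c) -> formula L}) :
  godel (App c a) = code_app (fun i => godel (a i)).
Proof. by []. Qed.

Lemma code_inj : injective CodeSeq.code.
Proof. exact: can_inj CodeSeq.codeK. Qed.

(** The generated principle gives no hypothesis for the arguments, which are
    nested inside a finite function. *)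
Lemma formula_induction (P : formula L -> Prop) :
  (forall n, P (Var n)) ->
  (forall c (a : {ffun 'I_(arity c) -> formula L}),
     (forall i, P (a i)) -> P (App c a)) ->
  forall F, P F.
Proof.
move=> PVar PApp; fix IH 1; case=> [n|c a]; first exact: PVar.
by apply: PApp => i; apply: IH.
Qed.

Lemma eq_code_app c (h h' : 'I_(arity c) -> nat) :
  code_app h = code_app h' -> h =1 h'.
Proof.
move/code_inj => [] /eq_in_map hh' i.
by apply: hh'; rewrite mem_enum.
Qed.

Lemma code_app_gt c (h : 'I_(arity c) -> nat) i : h i < code_app h.
Proof.
have /allP := CodeSeq.ltn_code
  ((enum_rank c).+1 :: [seq h i | i <- enum 'I_(arity c)]).
by apply; rewrite inE map_f ?orbT ?mem_enum.
Qed.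

(** Non-codes are absorbing: a symbolic application that codes a formula has
    codes of formulas as arguments. *)
Lemma code_app_inv c (h : 'I_(arity c) -> nat) F :
  godel F = code_app h ->
  exists2 a : {ffun 'I_(arity c) -> formula L},
    F = App c a & forall i, godel (a i) = h i.
Proof.
case: F => [n e|c' a e]; first by have := code_inj e.
have ec : c' = c by have [/ord_inj/enum_rank_inj] := code_inj e.
by subst c'; exists a => //; apply: (@eq_code_app c (fun i => godel (a i))).
Qed.

Lemma godel_inj : injective (@godel L).
Proof.
elim/formula_induction => [n|c a IH] G.
  by case: G => [m|c b] e; have // := code_inj e; case=> ->.
rewrite godel_App => /esym/code_app_inv [b -> ab]; congr App; apply/ffunP => i.
by apply: IH; rewrite ab.
Qed.

Lemma depth_le_godel F : depth F <= godel F.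
Proof.
elim/formula_induction: F => [//|c a IH].
rewrite [depth _]/= godel_App.
have : \max_(i < arity c) depth (a i) <= (code_app (fun i => godel (a i))).-1.
  apply/bigmax_leqP => i _; have := code_app_gt (fun i => godel (a i)) i.
  by move=> lt_g; rewrite (leq_trans (IH i)) // -ltnS (ltn_predK lt_g).
by rewrite -ltnS prednK // /code_app /= muln_gt0 expn_gt0.
Qed.

Lemma depth_subst s F : depth F <= depth (subst s F).
Proof.
elim/formula_induction: F => [//|c a IH] /=; rewrite ltnS.
by apply/bigmax_leqP => i _; rewrite (bigmax_sup i) // ffunE.
Qed.

Lemma recursive_code_app n c (h : 'I_(arity c) -> n.-tuple nat -> nat) :
  (forall i, recursive (h i)) -> recursive (fun x => code_app (fun i => h i x)).
Proof.
move=> rh; apply: recursive_code_cons; first exact: recursive_const.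
exact: recursive_code_map.
Qed.

(** * Recognizing formulas and computing their depth *)

(** The value recorded in the table t for the i-th argument of the application
    coded by u: the entry of u at i.+1 follows the entry for the connective,
    and t lists the values at u.-1, ..., 0 in this order. *)
Definition arg_lookup u t i := code_nth t (u - (code_nth u i.+1).+1).

(** The value computed at u is 0 if u is not the code of a formula and depth
    plus one otherwise.  The factors test that u is an application of c and
    that each argument is a formula; the last one is the depth of the
    application plus one, and at most one connective contributes. *)
Definition depth_step_app u t c : nat :=
  (u == code_app (fun i : 'I_(arity c) => code_nth u i.+1)) *
  (\prod_(i < arity c) (0 < arg_lookup u t i)) *
  (\max_(i < arity c) (arg_lookup u t i).-1).+2.

Definition depth_step u t : nat :=
  (u == CodeSeq.code [:: 0; code_nth u 1]) +
  \sum_(c : connective L) depth_step_app u t c.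

Lemma recursive2_depth_step : recursive2 depth_step.
Proof.
have ru := recursive_proj (ord0 : 'I_2).
have rt := recursive_proj (inord 1 : 'I_2).
have rnth i : recursive (fun x : 2.-tuple nat => code_nth (tnth x ord0) i).
  by apply: recursive_code_nth => //; apply: recursive_const.
have rlookup i : recursive (fun x : 2.-tuple nat =>
    arg_lookup (tnth x ord0) (tnth x (inord 1)) i).
  apply: recursive_code_nth => //; apply: recursive_sub => //.
  exact: recursive_succ.
apply: recursive_add.
  apply: recursive_eq => //; apply: recursive_code_cons.
    exact: recursive_const.
  by apply: recursive_code_cons => //; apply: recursive_const.
apply: recursive_bigop => [f g|c]; first exact: recursive_add.
apply: recursive_mul.
  apply: recursive_mul.
    by apply: recursive_eq => //; apply: recursive_code_app.
  apply: recursive_bigop => [f g|i]; first exact: recursive_mul.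
  by apply: recursive_leq => //; apply: recursive_const.
do 2!apply: recursive_succ.
apply: recursive_bigop => [f g|i]; first exact: recursive_max.
exact: recursive_pred.
Qed.

Lemma code_nth_app c (h : 'I_(arity c) -> nat) (i : 'I_(arity c)) :
  code_nth (code_app h) i.+1 = h i.
Proof.
rewrite /code_nth CodeSeq.codeK /= (nth_map i) ?size_enum_ord //.
by congr h; apply: val_inj; rewrite /= nth_enum_ord.
Qed.

Lemma arg_lookup_app (D : nat -> nat) c (h : 'I_(arity c) -> nat)
    (i : 'I_(arity c)) :
  let u := code_app h in
  arg_lookup u (CodeSeq.code (rev (mkseq D u))) i = D (h i).
Proof.
have lt_h := code_app_gt h i.
rewrite /arg_lookup code_nth_app /code_nth CodeSeq.codeK nth_rev size_mkseq.
  by rewrite subnSK // subKn 1?ltnW // nth_mkseq.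
by rewrite ltn_subrL (leq_ltn_trans _ lt_h).
Qed.

(** A single recursive function serves both to tell formulas from other
    numbers and to search for formulas of large depth. *)
Lemma code_depth :
  exists2 D : nat -> nat, recursive1 D &
    (forall F, D (godel F) = (depth F).+1) /\
    (forall u, 0 < D u -> exists F, godel F = u).
Proof.
have [D rD DE] := course_of_values recursive2_depth_step; exists D => //.
have Dvar n : D (godel (Var n : formula L)) = 1.
  have arg1 : code_nth (godel (Var n : formula L)) 1 = n.
    exact: (congr1 (nth 0 ^~ 1) (CodeSeq.codeK [:: 0; n])).
  rewrite DE /depth_step arg1 eqxx big1 // => c _.
  by rewrite /depth_step_app; case: eqP => // /code_inj.
have Dapp c (h : 'I_(arity c) -> nat) : (forall i, 0 < D (h i)) ->
    D (code_app h) = (\max_(i < arity c) (D (h i)).-1).+2.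
  move=> Dh; rewrite DE /depth_step; case: eqP => [/code_inj //|_].
  rewrite add0n (bigD1 c) //= big1 ?addn0 => [|c' neq_c].
    rewrite {1}/depth_step_app [code_app _ == _](_ : _ = true); last first.
      apply/eqP; congr CodeSeq.code; congr (_ :: _).
      by apply: eq_map => i; rewrite code_nth_app.
    rewrite big1 => [|i _]; last by rewrite arg_lookup_app Dh.
    by rewrite !mul1n; congr _.+2; apply: eq_bigr => i _; rewrite arg_lookup_app.
  rewrite /depth_step_app; case: eqP => // /code_inj [/ord_inj/enum_rank_inj ec].
  by rewrite ec eqxx in neq_c.
split.
  elim/formula_induction => [n|c a IH]; first exact: Dvar.
  rewrite godel_App Dapp => [|i]; last by rewrite IH.
  by rewrite /=; congr _.+2; apply: eq_bigr => i _; rewrite IH.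
move=> u; have [m] := ubnP u; elim: m u => // m IHm u lt_um.
rewrite DE /depth_step; case: eqP => [-> _|_].
  by exists (Var (code_nth u 1)).
rewrite add0n lt0n sum_nat_eq0 negb_forall => /existsP [c].
rewrite /depth_step_app; case: (u =P _) => [|_]; last by rewrite !mul0n.
move: (fun i : 'I_ _ => _) => h uE; rewrite {}uE in lt_um * => nz.
have Dh i : 0 < D (h i).
  by case: posnP nz => // D0; rewrite (bigD1 i) //= arg_lookup_app D0.
have /fin_all_exists [a aE] : forall i, exists F, godel F = h i.
  by move=> i; apply: IHm => //; apply: leq_trans (code_app_gt h i) lt_um.
exists (App c [ffun i => a i]); congr CodeSeq.code; congr (_ :: _).
by apply: eq_map => i; rewrite -aE ffunE.
Qed.

(** * The truncated logics *)

Section TruncatedLogic.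

Variables (R : pred nat) (n : nat).

(** The predicate R is meant to hold of the codes of non-theorems.  The top
    value n and the numbers that code no formula are thus designated. *)
Definition truncated_logic : mvlogic L :=
  @MVLogic L 'I_n.+1 [set u : 'I_n.+1 | (u == n :> nat) || ~~ R u]
    (fun c a => inord (minn (code_app (fun i => nat_of_ord (a i))) n)).

(** Truncating early is harmless: an argument of size at least n makes the
    application oversized before and after its own truncation. *)
Lemma minn_code_app c (h : 'I_(arity c) -> nat) :
  minn (code_app (fun i => minn (h i) n)) n = minn (code_app h) n.
Proof.
have [/forallP lt_hn|] := boolP [forall i, h i < n].
  congr (minn (CodeSeq.code (_ :: _)) n); apply: eq_map => i.
  by apply/minn_idPl/ltnW.
rewrite negb_forall => /existsP [i]; rewrite -leqNgt => le_nh.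
(* Both applications are bigger than their oversized i-th argument. *)
have := code_app_gt h i; have := code_app_gt (fun i => minn (h i) n) i.
rewrite (minn_idPr le_nh) => /ltnW/minn_idPr -> /ltnW lt_h.
by apply/esym/minn_idPr; apply: leq_trans lt_h.
Qed.

Lemma value_truncated_app (v : nat -> truth_value truncated_logic) c
    (a : {ffun 'I_(arity c) -> formula L}) :
  value v (App c a) =
  minn (code_app (fun i => nat_of_ord (value v (a i)))) n :> nat.
Proof.
rewrite /= inordK ?ltnS ?geq_minr //; congr (minn (CodeSeq.code (_ :: _)) n).
by apply: eq_map => i; rewrite ffunE.
Qed.

(** A substitution followed by truncation is a valuation, and truncation
    commutes with the connectives. *)
Lemma value_truncated_subst (v : nat -> truth_value truncated_logic) s :
  (forall k, v k = minn (godel (s k)) n :> nat) ->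
  forall F, value v F = minn (godel (subst s F)) n :> nat.
Proof.
move=> vs; elim/formula_induction => [//|c a IH].
rewrite value_truncated_app [subst _ _]/= godel_App -minn_code_app.
rewrite -[RHS]minn_code_app.
congr (minn (CodeSeq.code (_ :: _)) n); apply: eq_map => i.
by rewrite IH ffunE -minnA minnn.
Qed.

(** Conversely, a value below n that codes a formula was computed without any
    truncation and from codes of formulas only, so it is a substitution
    instance.  Variables irrelevant to F may take other values, hence s is
    constrained only where the valuation gives a code. *)
Lemma subst_of_value (v : nat -> truth_value truncated_logic) s :
  (forall k G, godel G = v k :> nat -> s k = G) ->
  forall F G, godel G = value v F :> nat -> godel G < n -> subst s F = G.
Proof.
move=> vs; elim/formula_induction => [k G vG _|c a IH G]; first exact: vs.
rewrite value_truncated_app => gG lt_Gn.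
have {}gG : godel G = code_app (fun i => nat_of_ord (value v (a i))).
  rewrite gG; apply/minn_idPl.
  by move: lt_Gn; rewrite gG gtn_min ltnn orbF => /ltnW.
have [b GE bE] := code_app_inv gG; rewrite GE /=; congr App.
apply/ffunP => i; rewrite ffunE; apply: IH => //.
rewrite bE (leq_trans _ (ltnW lt_Gn)) // gG.
exact: (code_app_gt (fun i => nat_of_ord (value v (a i)))).
Qed.

Hypothesis R_code : forall u, R u -> exists F, godel F = u.

(** Only values that code a formula and lie below n can be undesignated, and
    by the two preceding lemmas these are the codes of instances of F. *)
Lemma Taut_truncated F :
  Taut truncated_logic F <->
  forall s, godel (subst s F) < n -> ~~ R (godel (subst s F)).
Proof.
split=> [tF s lt_n | sF v].
  pose v k : truth_value truncated_logic := inord (minn (godel (s k)) n).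
  have /(value_truncated_subst) vF k : v k = minn (godel (s k)) n :> nat.
    by rewrite inordK // ltnS geq_minr.
  have := tF v; rewrite inE vF (minn_idPl (ltnW lt_n)).
  by rewrite (ltn_eqF lt_n).
rewrite inE; apply/norP => -[neq_n]; rewrite negbK => Rv.
have [G gG] := R_code Rv.
(* Where the valuation gives no code of a formula, s k is arbitrary. *)
pose s k := epsilon (inhabits (Var 0)) (fun G => godel G = v k :> nat).
have vs k H : godel H = v k :> nat -> s k = H.
  move=> gH; apply: godel_inj; rewrite gH.
  by apply: (epsilon_spec _ (fun G => godel G = v k :> nat)); exists H.
have lt_Gn : godel G < n by rewrite gG ltn_neqAle neq_n -ltnS ltn_ord.
have sFG := subst_of_value vs gG lt_Gn.
by have := sF s; rewrite sFG gG Rv -gG lt_Gn => /(_ isT).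
Qed.

End TruncatedLogic.

Lemma recursive_truncated (R : pred nat) (N : nat -> nat) :
  recursive1 R -> recursive1 N ->
  recursive_sequence (fun i => truncated_logic R (N i)).
Proof.
move=> rR rN.
exists (fun x => (N (tnth x ord0)).+1).
exists (fun x => (tnth x (inord 1) == N (tnth x ord0)) || ~~ R (tnth x (inord 1))).
exists (fun c x => minn (code_app (fun j : 'I_(arity c) => tnth x (lift ord0 j)))
                        (N (tnth x ord0))).
split.
- exact: recursive_succ.
- apply: recursive_or.
    apply: recursive_eq; first exact: recursive_proj.
    by apply: (recursive_comp1 rN); apply: recursive_proj.
  apply: recursive_neg; apply: (recursive_comp1 rR); exact: recursive_proj.
- move=> c; apply: recursive_min.
    by apply: recursive_code_app => j; apply: recursive_proj.
  by apply: (recursive_comp1 rN); apply: recursive_proj.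
move=> i _; split.
- by rewrite card_ord (tnth_nth 0).
- move=> u; rewrite inE !(tnth_nth 0) /= inordK //= enum_rank_ord /=.
  by case: (_ || _).
move=> c a; rewrite enum_rank_ord /= inordK ?ltnS ?geq_minr //.
congr (minn (CodeSeq.code (_ :: _)) _); apply: eq_map => j.
by rewrite tnthS tnth_mktuple enum_rank_ord.
Qed.

(** * Separating the approximations *)

(** If non-theorems have bounded depth there is nothing to separate and any
    increasing recursive N will do; otherwise the search for a non-theorem
    deeper than N i terminates, and one more than its code is the next
    threshold. *)
Lemma separating_thresholds (Lg : formula L -> Prop) (D : nat -> nat)
    (R : pred nat) :
  recursive1 D -> recursive1 R ->
  (forall F, D (godel F) = (depth F).+1) ->
  (forall F, ~ Lg F -> R (godel F)) ->
  (forall u, R u -> exists F, godel F = u) ->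
  exists N : nat -> nat,
    [/\ recursive1 N, forall i, N i < N i.+1 &
        deep_nontheorems Lg -> forall i, exists F,
          [/\ R (godel F), N i < depth F & godel F < N i.+1]].
Proof.
move=> rD rR DE RLg R_code.
have [deep|shallow] := classic (deep_nontheorems Lg); last first.
  by exists id; split=> //; apply: recursive_proj.
(* The value of D is depth plus one, so depth above n reads n.+1 < D u. *)
have exw n : exists u, R u && (n.+1 < D u).
  by have [F ltF nF] := deep n; exists (godel F); rewrite DE ltnS ltF RLg.
pose w n := ex_minn (exw n).
have rw : recursive1 w.
  apply: (@recursive1_mu (fun u n => R u && (n.+1 < D u))).
  - apply: recursive_neg; apply: recursive_and.
      exact: (recursive_comp1 rR (recursive_proj _)).
    apply: recursive_leq; last exact: (recursive_comp1 rD (recursive_proj _)).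
    by do 2!apply: recursive_succ; apply: recursive_proj.
  - by move=> n; rewrite /w; case: ex_minnP.
  - by move=> n u Pu; rewrite /w; case: ex_minnP => m _; apply.
pose N := fix N i := if i is j.+1 then (w (N j)).+1 else 0.
have sepN i : exists F, [/\ R (godel F), N i < depth F & godel F < N i.+1].
  have : R (w (N i)) && ((N i).+1 < D (w (N i))).
    by rewrite {1 2}/w; case: ex_minnP.
  case/andP => Rw; have [F gF] := R_code _ Rw; rewrite -gF DE ltnS => lt_d.
  by exists F; split; rewrite ?gF //= gF.
exists N; split=> //.
  apply: (@recursive1_prim 0 (fun _ y => (w y).+1)) => //.
  by apply: recursive_succ; apply: (recursive_comp1 rw); apply: recursive_proj.
move=> i; have [F [_ lt_d lt_g]] := sepN i.
exact: leq_ltn_trans (leq_trans (ltnW lt_d) (depth_le_godel F)) lt_g.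
Qed.

End Formulas.

Lemma subst_Var L (F : formula L) : subst Var F = F.
Proof.
elim/formula_induction: F => [//|c a IH] /=; congr App.
by apply/ffunP => i; rewrite ffunE.
Qed.

Theorem proposition6p1 (L : language) (Lg : formula L -> Prop)
    (hLg : propositional_logic Lg) (hdec : decidable_logic Lg) :
  exists A : nat -> mvlogic L,
    recursive_sequence A /\
    (forall i j, 0 < i -> 0 < j ->
       (j <= i -> mv_le (A i) (A j)) /\
       (deep_nontheorems Lg -> mv_le (A i) (A j) -> j <= i)) /\
    (forall i, 0 < i -> forall F, Lg F -> Taut (A i) F) /\
    (forall F, Lg F <-> (forall i, 2 <= i -> Taut (A i) F)).
Proof.
have [d rd dLg] := hdec; have [D rD [DE Dcode]] := code_depth L.
pose R u := (0 < D u) && (d [tuple u] != 1).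
have LgR F : Lg F <-> ~~ R (godel F).
  by rewrite /R DE /= negbK; split=> [/dLg/eqP | /eqP/dLg].
have rR : recursive1 R.
  apply: recursive_and.
    by apply: recursive_leq => //; apply: recursive_const.
  apply: recursive_neg; apply: recursive_eq; last exact: recursive_const.
  apply: (recursive_ext rd) => x; congr d.
  by apply: eq_from_tnth => i; rewrite !(tnth_nth 0) (ord1 i).
have R_code u : R u -> exists F : formula L, godel F = u by case/andP => /Dcode.
have RLg F : ~ Lg F -> R (godel F) by move=> nF; apply: contraT => /LgR.
have [N [rN incN sepN]] := separating_thresholds rD rR DE RLg R_code.
have TautE i F := Taut_truncated (N i) R_code F.
have leN : {homo N : i j / i <= j}.
  by apply: homo_leq => [//|? ? ?|i]; [exact: leq_trans | exact: ltnW].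
have geN i : i <= N i by elim: i => // i IHi; apply: leq_ltn_trans IHi (incN _).
exists (fun i => truncated_logic L R (N i)); split; first exact: recursive_truncated.
have anti i j : j <= i ->
    mv_le (truncated_logic L R (N i)) (truncated_logic L R (N j)).
  move=> le_ji F /TautE tF; apply/TautE => s lt_s.
  exact/tF/(leq_trans lt_s)/leN.
split; last split.
- move=> i j _ _; split; first exact: anti.
  move=> deep le_ij; rewrite leqNgt; apply/negP => lt_ij.
  (* F holds at level i, as its instances are too large, but fails at i + 1. *)
  have [F [RF lt_d lt_g]] := sepN deep i.
  have /le_ij/(anti _ _ lt_ij)/TautE : Taut (truncated_logic L R (N i)) F.
    apply/TautE => s; rewrite ltnNge (leq_trans (ltnW lt_d)) //.
    exact: leq_trans (depth_subst s F) (depth_le_godel _).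
  by move/(_ Var); rewrite subst_Var RF => /(_ lt_g).
- by move=> i _ F LF; apply/TautE => s _; apply/LgR/hLg.
move=> F; split=> [LF i _|tF]; first by apply/TautE => s _; apply/LgR/hLg.
(* Any index at least 2 and above the code of F works. *)
have /TautE/(_ Var) := tF (godel F).+2 isT; rewrite subst_Var => tF'.
by apply/LgR/tF'; apply: leq_trans (geN _).
Qed.
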